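(* Let $p,q$ be integers with $\Delta=p^2-4q\neq 0$. The generating function $g^{(2)}(x)=\sum_{n=0}^{\infty}U_n^{(2)}x^n$ (as a formal power series) satisfies $$g^{(2)}(x)=\frac{x^{2}}{1-px+pqx^{3}-q^{2}x^{4}}.$$
   Context: For integers $p,q$, $(U_n)_{n\geq0}$ is defined by $U_0=0$, $U_1=1$, $U_n=pU_{n-1}-qU_{n-2}$ ($n\geq2$). With $\alpha=\frac{p+\sqrt{\Delta}}{2}$, $\beta=\frac{p-\sqrt{\Delta}}{2}$, for $n=2m+r$ with $m\geq0$, $r\in\{0,1\}$, define $U_n^{(2)}=\frac{1}{(\alpha-\beta)^2}(\alpha^{m+1}-\beta^{m+1})^{r}(\alpha^{m}-\beta^{m})^{2-r}$; equivalently $U_{2m}^{(2)}=U_m^2$ and $U_{2m+1}^{(2)}=U_mU_{m+1}$. *)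

(* Defs.v *)
From HB Require Import structures.
From mathcomp Require Import all_boot all_order all_algebra.

Set Implicit Arguments.
Unset Strict Implicit.
Unset Printing Implicit Defensive.

Import Order.TTheory GRing.Theory Num.Theory.

Local Open Scope ring_scope.

Section FormalPowerSeries.

Variable R : comUnitRingType.

(* A formal power series is its sequence of coefficients: a stands for
   sum_n (a n) x^n, with no convergence involved. *)
Definition fps := nat -> R.

Definition fps_of_poly (P : {poly R}) : fps := fun n => P`_n.

Definition fps_mul (a b : fps) : fps :=
  fun n => \sum_(i < n.+1) a i * b (n - i)%N.

(* The first n coefficients of 1/a, obtained by solving
   sum_(i <= m) b_i a_(m - i) = [m = 0] for b_m, successively for each m < n. *)
Fixpoint fps_inv_seq (a : fps) (n : nat) : seq R :=
  if n is m.+1 then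
    let s := fps_inv_seq a m in
    rcons s ((a 0%N)^-1 *
             ((m == 0)%N%:R - \sum_(i < m) s`_i * a (m - i)%N))
  else [::].

(* Only meaningful when the constant term of a is a unit; see fps_mulVf. *)
Definition fps_inv (a : fps) : fps := fun n => (fps_inv_seq a n.+1)`_n.

Definition fps_div (a b : fps) : fps := fps_mul a (fps_inv b).

Lemma size_fps_inv_seq a n : size (fps_inv_seq a n) = n.
Proof. by elim: n => //= n IHn; rewrite size_rcons IHn. Qed.

Lemma nth_fps_inv_seq a n i :
  (i < n)%N -> (fps_inv_seq a n)`_i = fps_inv a i.
Proof.
elim: n => // n IHn; rewrite ltnS leq_eqVlt => /orP[/eqP -> // | lt_in].
by rewrite /= nth_rcons size_fps_inv_seq lt_in IHn.
Qed.

Lemma fps_invE a n :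
  fps_inv a n = (a 0%N)^-1 *
    ((n == 0)%N%:R - \sum_(i < n) fps_inv a i * a (n - i)%N).
Proof.
rewrite {1}/fps_inv /= nth_rcons size_fps_inv_seq ltnn eqxx.
congr (_ * (_ - _)); apply: eq_bigr => i _.
by rewrite nth_fps_inv_seq.
Qed.

Lemma fps_mulVf a :
  a 0%N \is a GRing.unit -> fps_mul (fps_inv a) a =1 fps_of_poly 1.
Proof.
move=> Ua n; rewrite /fps_mul /fps_of_poly big_ord_recr /= subnn coef1.
by rewrite fps_invE mulrAC mulVr // mul1r addrC subrK.
Qed.

End FormalPowerSeries.

Section LucasSquare.

(* C is any model of the complex numbers, e.g. algC or R[i]; sqrtC is total,
   so sqrtC D is defined also for D < 0. *)
Variables (C : numClosedFieldType) (p q : int).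

Definition Delta : int := p ^+ 2 - 4 * q.

Definition alpha : C := (p%:~R + sqrtC Delta%:~R) / 2.
Definition beta : C := (p%:~R - sqrtC Delta%:~R) / 2.

Definition U2 (n : nat) : C :=
  let m := n./2 in
  let r : nat := odd n in
  1 / (alpha - beta) ^+ 2 *
  (alpha ^+ m.+1 - beta ^+ m.+1) ^+ r * (alpha ^+ m - beta ^+ m) ^+ (2 - r).

Definition g2 : fps C := fun n => U2 n.

End LucasSquare.

(* Main.v *)
(** Write [c_n] for the coefficients of [g2]. Substituting [p = alpha + beta]
    and [q = alpha * beta] in the recurrence
    [c_(n+4) = p c_(n+3) - p q c_(n+1) + q^2 c_n] turns it, for each parity of
    [n], into a rational identity in [alpha], [beta], [alpha^m], [beta^m].
    Together with the values [0, 0, 1, p] of [c_0, ..., c_3] this says that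
    [g2] times the denominator is [x^2], and the denominator is invertible
    because its constant term is 1. *)
Require Import Defs.
From HB Require Import structures.
From mathcomp Require Import all_boot all_order all_algebra.
From mathcomp Require Import ring.
From Stdlib Require Import FunctionalExtensionality.

Set Implicit Arguments.
Unset Strict Implicit.
Unset Printing Implicit Defensive.

Import Order.TTheory GRing.Theory Num.Theory.

Local Open Scope ring_scope.

Section FpsTheory.

Variable R : comUnitRingType.
Implicit Types (a b c : fps R) (P : {poly R}) (N n : nat).

(** A coefficient of index below [N] only sees the truncations at [N], so the ring laws of
    polynomials carry over to series. *)
Lemma fps_mul_coefM a b N n : (n < N)%N ->
  fps_mul a b n = ((\poly_(i < N) a i) * (\poly_(i < N) b i))`_n.
Proof.
move=> ltnN; rewrite coefM; apply: eq_bigr => i _.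
rewrite !coef_poly (leq_ltn_trans (leq_subr i n) ltnN).
by rewrite (leq_ltn_trans (leq_ord i) ltnN).
Qed.

Lemma fps_mul_poly a P n :
  fps_mul a (fps_of_poly P) n = ((\poly_(i < n.+1) a i) * P)`_n.
Proof. by rewrite coefM; apply: eq_bigr => i _; rewrite coef_poly ltn_ord. Qed.

Lemma eq_fps_mul a a' b b' :
  a =1 a' -> b =1 b' -> fps_mul a b =1 fps_mul a' b'.
Proof. by move=> eqa eqb n; apply: eq_bigr => i _; rewrite eqa eqb. Qed.

Lemma fps_mulC a b : fps_mul a b =1 fps_mul b a.
Proof. by move=> n; rewrite !(fps_mul_coefM _ _ (ltnSn n)) mulrC. Qed.

Lemma fps_mulA a b c : fps_mul a (fps_mul b c) =1 fps_mul (fps_mul a b) c.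
Proof.
move=> n; pose t (f : fps R) := \poly_(i < n.+1) f i.
have mulE f g i : (i < n.+1)%N -> fps_mul f g i = (t f * t g)`_i.
  exact: fps_mul_coefM.
(* All inner indices are at most [n], so a single truncation serves both nested products. *)
transitivity ((t a * (t b * t c))`_n).
  rewrite coefM; apply: eq_bigr => i _.
  by rewrite mulE ?ltnS ?leq_subr // coef_poly ltn_ord.
rewrite mulrA coefM; apply: eq_bigr => i _.
by rewrite mulE // coef_poly ltnS leq_subr.
Qed.

Lemma fps_mulr1 a : fps_mul a (fps_of_poly 1) =1 a.
Proof. by move=> n; rewrite fps_mul_poly mulr1 coef_poly ltnSn. Qed.

(** Since [a = a * (b / b) = (a * b) / b], checking a product replaces any computation with
    [fps_inv]. *)
Lemma fps_divP a b c :
  b 0%N \is a GRing.unit -> fps_mul a b =1 c -> a =1 fps_div c b.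
Proof.
move=> Ub abc n; rewrite -(fps_mulr1 a n).
have b1 : fps_of_poly 1 =1 fps_mul b (fps_inv b).
  by move=> i; rewrite fps_mulC fps_mulVf.
by rewrite (eq_fps_mul (frefl a) b1) fps_mulA; apply: eq_fps_mul.
Qed.

End FpsTheory.

Section LucasSquareTheory.

Variables (C : numClosedFieldType) (p q : int).

Local Notation a := (alpha C p q).
Local Notation b := (beta C p q).
Local Notation U := (U2 C p q).

Lemma alphaDbeta : a + b = p%:~R.
Proof. by rewrite /alpha /beta; field. Qed.

Lemma alphaMbeta : a * b = q%:~R.
Proof.
have s2 : sqrtC (Delta p q)%:~R ^+ 2 = p%:~R ^+ 2 - 4 * q%:~R :> C.
  by rewrite sqrtCK /Delta rmorphB rmorphXn rmorphM.
rewrite /alpha /beta; set s := sqrtC _ in s2 *.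
(* Difference of squares: the root [s] survives only through its square, given by [s2]. *)
transitivity ((p%:~R ^+ 2 - s ^+ 2) / 4); first by field.
by rewrite s2; field.
Qed.

Lemma alphaBbeta_neq0 : Delta p q <> 0 -> a - b != 0.
Proof.
move=> D0; have -> : a - b = sqrtC (Delta p q)%:~R.
  by rewrite /alpha /beta; field.
by rewrite sqrtC_eq0 intr_eq0; apply/eqP.
Qed.

Lemma U2_double m : U m.*2 = (a ^+ m - b ^+ m) ^+ 2 / (a - b) ^+ 2.
Proof. by rewrite /U2 odd_double doubleK expr0 mulr1 mulrC mul1r. Qed.

Lemma U2_doubleS m :
  U m.*2.+1 = (a ^+ m.+1 - b ^+ m.+1) * (a ^+ m - b ^+ m) / (a - b) ^+ 2.
Proof.
by rewrite /U2 /= odd_double uphalf_double !expr1 mul1r -mulrA mulrC.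
Qed.

Lemma U2_rec n : Delta p q <> 0 ->
  U n.+4 = p%:~R * U n.+3 - p%:~R * q%:~R * U n.+1 + q%:~R ^+ 2 * U n.
Proof.
move=> /alphaBbeta_neq0 ab0; rewrite -alphaDbeta -alphaMbeta.
rewrite -(odd_double_half n); case: (odd n); set m := n./2;
  rewrite ?add0n ?add1n -!doubleS !U2_doubleS !U2_double !exprS;
  by field.
Qed.

Lemma U2_init : Delta p q <> 0 ->
  [/\ U 0 = 0, U 1 = 0, U 2 = 1 & U 3 = p%:~R].
Proof.
move=> /alphaBbeta_neq0 ab0; rewrite -alphaDbeta.
rewrite (U2_double 0) (U2_doubleS 0) (U2_double 1) (U2_doubleS 1).
by split; field.
Qed.

End LucasSquareTheory.

Theorem theorem5 (C : numClosedFieldType) (p q : int) (hD : Delta p q <> 0) :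
  g2 C p q =
  fps_div (fps_of_poly 'X^2)
    (fps_of_poly (1 - p%:~R *: 'X + (p * q)%:~R *: 'X^3
                    - (q ^+ 2)%:~R *: 'X^4)).
Proof.
apply: functional_extensionality; apply: fps_divP => [|n].
  rewrite /fps_of_poly !(coefB, coefD, coefZ, coef1, coefX, coefXn) /=.
  by rewrite !mulr0 !subr0 addr0 unitr1.
have [e0 e1 e2 e3] := U2_init C hD.
rewrite fps_mul_poly /fps_of_poly coefXn mulrBr mulrDr mulrBr mulr1.
(* With ['X] seen as a first power, [coefMXn] turns every term into an index shift. *)
rewrite -!scalerAr -['X]expr1 !(coefB, coefD, coefZ) !coefMXn !coef_poly.
rewrite rmorphM rmorphXn /g2.
(* Below index 4 some shifts leave the range and the initial values decide; from 4 on the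
   coefficient vanishes by [U2_rec]. *)
case: n => [|[|[|[|n]]]] /=; rewrite ?subSS ?subn0 /= ?ltnS ?leqnn.
- by rewrite e0; ring.
- by rewrite e0 e1; ring.
- by rewrite e1 e2; ring.
- by rewrite e0 e2 e3; ring.
(* The remaining guards are truncation bounds, all satisfied. *)
rewrite !ifT; try by do ?apply: leqW.
by rewrite (U2_rec C n hD); ring.
Qed.
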